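(* Let $C\in\mathbb{R}^{n\times n}$ be symmetric and let $d=nr$. For $x=[x_1^\top,\dots,x_n^\top]^\top\in\mathbb{R}^d$ with $x_i\in\mathbb{R}^r$, let $V\in\mathbb{R}^{n\times r}$ be the matrix with rows $x_1^\top,\dots,x_n^\top$, and set $f(x)=-\langle C,VV^\top\rangle$ and $A(x)=\operatorname{diag}(VV^\top)-1_n\in\mathbb{R}^n$. Let $\beta>0$ and let $$L_\beta(x,y)=f(x)+\langle A(x),y\rangle+\frac{\beta}{2}\|A(x)\|^2$$ be the augmented Lagrangian of the Burer-Monteiro factorized problem $\min_V -\langle C,VV^\top\rangle$ subject to $\operatorname{diag}(VV^\top)=1_n$. Then, with respect to the primal variable $x\in\mathbb{R}^d$ and for a fixed multiplier $y\in\mathbb{R}^n$, the following statements hold. (i) For any $L_1>0$ there exists $L_0>0$ such that $L_\beta(\cdot,y)$ is $(L_0,L_1)$-smooth. (ii) If $\phi$ is a reference function on $\mathbb{R}^{d}$ satisfying conditions (S) and (I) given in the context, then for any $\bar L>0$ there exists an $L>0$ such that $L_\beta(\cdot,y)$ satisfies the second-order characterization of $(L,\bar L)$-anisotropic smoothness relative to $\phi$.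
   Context: $\langle X,Y\rangle=\operatorname{trace}(X^\top Y)$ for matrices; $\operatorname{diag}(X)\in\mathbb{R}^n$ is the vector of diagonal entries of $X$; $1_n$ is the all-ones vector. $\|\cdot\|$ is the Euclidean norm on vectors and the spectral norm on matrices; $\mathbb{R}_+=[0,\infty)$. A twice continuously differentiable $g:\mathbb{R}^d\to\mathbb{R}$ is $(L_0,L_1)$-smooth, with $L_0,L_1\ge0$, if $\|\nabla^2 g(x)\|\le L_0+L_1\|\nabla g(x)\|$ for all $x$. Standing assumption: a reference function is a function $\phi:\mathbb{R}^d\to\overline{\mathbb{R}}$ that is proper, lower semicontinuous, strongly convex and even, with $\phi(0)=0$; $\phi^*$ is its convex conjugate. $g$ satisfies the second-order characterization of $(L,\bar L)$-anisotropic smoothness relative to $\phi$ if $\lambda_{\max}(\nabla^2\phi^*(\bar L^{-1}\nabla g(x))\nabla^2 g(x))\le L\bar L$ for all $x\in\mathbb{R}^d$. Condition (S): $\operatorname{int}\operatorname{dom}\phi\ne\emptyset$; $\phi\in\mathcal{C}^2(\operatorname{int}\operatorname{dom}\phi)$; and for any sequence $(x^k)$ converging to some boundary point of $\operatorname{int}\operatorname{dom}\phi$, $\|\nabla\phi(x^k)\|\to\infty$. (This ensures in particular $\phi^*\in\mathcal{C}^2(\mathbb{R}^d)$.) Condition (I): $\phi$ is isotropic, i.e. $\phi(x)=h(\|x\|)$ for a scalar kernel function $h:\mathbb{R}\to\mathbb{R}_+\cup\{\infty\}$, and, with $h^*$ the convex conjugate of $h$: (i) ${h^*}'(y)/y$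 is a decreasing function on $\mathbb{R}_+$; (ii) $\lim_{y\to+\infty}y\,{h^*}''(y)=C_2$ for some $C_2\in\mathbb{R}_+$; (iii) $\lim_{y\to+\infty}{h^*}'(s_q(y))/y=0$ for any polynomial $s_q(\alpha)=\sum_{i=0}^q u_i\alpha^i$ of degree $q$. *)

(* Defs.v *)
From HB Require Import structures.
From mathcomp Require Import all_boot all_order all_algebra.
From mathcomp Require Import all_classical all_reals all_analysis.
Set Implicit Arguments.
Unset Strict Implicit.
Unset Printing Implicit Defensive.
Import Order.TTheory GRing.Theory Num.Theory.
Import numFieldNormedType.Exports.
Local Open Scope classical_set_scope.
Local Open Scope ring_scope.

(* Points of R^d are row vectors. The library norm `|x| on matrices is the max
   norm; it gives the usual topology, but every norm that appears in a formula
   below is [enorm] (on vectors) or [specnorm] (on matrices). *)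

Section LinearAlgebra.
Context {R : realType}.

Definition inner m n (X Y : 'M[R]_(m, n)) : R := \tr (X^T *m Y).

Definition enorm m n (X : 'M[R]_(m, n)) : R := Num.sqrt (inner X X).

Definition specnorm m n (M : 'M[R]_(m, n)) : R :=
  sup [set enorm (M *m v) | v in [set v : 'cV[R]_n | enorm v <= 1]].

(* Used for products of a positive semidefinite and a symmetric matrix, all of
   whose eigenvalues are real. *)
Definition lambda_max n (M : 'M[R]_n) : R := sup [set a | eigenvalue M a].

Definition diagv n (X : 'M[R]_n) : 'rV[R]_n := \row_i X i i.

End LinearAlgebra.

Section Calculus.
Context {R : realType} {d : nat}.
Implicit Types (f g : 'rV[R]_d -> R) (U : set 'rV[R]_d) (x : 'rV[R]_d).

Definition grad f x : 'rV[R]_d := \row_i 'D_(delta_mx 0 i) f x.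

Definition hess f x : 'M[R]_d :=
  \matrix_(i, j) 'D_(delta_mx 0 i) ('D_(delta_mx 0 j) f) x.

(* Only meant for open U. *)
Definition C2_on U f : Prop := forall x, U x ->
  [/\ differentiable f x, differentiable (grad f) x & {for x, continuous (hess f)}].

Definition L0L1_smooth (L0 L1 : R) g : Prop :=
  [/\ 0 <= L0, 0 <= L1, C2_on setT g &
      forall x, specnorm (hess g x) <= L0 + L1 * enorm (grad g x)].

End Calculus.

Section ReferenceFunctions.
Context {R : realType}.

(* Convex conjugate with respect to a pairing: [inner] on R^d, product on R. *)
Definition conjugate (T : Type) (pair : T -> T -> R) (f : T -> \bar R) (y : T)
    : \bar R :=
  ereal_sup [set ((pair x y)%:E - f x)%E | x in setT].

Variable d : nat.
Implicit Types phi : 'rV[R]_d -> \bar R.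

Definition dom phi : set 'rV[R]_d := [set x | (phi x < +oo)%E].

Definition proper phi : Prop :=
  (forall x, (-oo < phi x)%E) /\ dom phi !=set0.

Definition strongly_convex phi : Prop :=
  exists2 mu : R, 0 < mu & forall (x z : 'rV[R]_d) (t : R), 0 <= t <= 1 ->
    (phi (t *: x + (1 - t) *: z)%R
       + (mu / 2 * (t * (1 - t)) * enorm (x - z) ^+ 2)%:E
     <= t%:E * phi x + (1 - t)%:E * phi z)%E.

Definition reference_function phi : Prop :=
  [/\ proper phi, lower_semicontinuous phi, strongly_convex phi,
      (forall x, phi (- x) = phi x) & phi 0 = 0%E].

(* phi^*, which is finite everywhere when phi is a reference function. *)
Definition conj_fun phi : 'rV[R]_d -> R := fine \o conjugate (@inner R 1 d) phi.

Definition cond_S phi : Prop :=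
  let U := interior (dom phi) in
  [/\ U !=set0,
      C2_on U (fine \o phi) &
      forall (xs : nat -> 'rV[R]_d) (b : 'rV[R]_d),
        (forall k, U (xs k)) -> (closure U `\` U) b -> xs @ \oo --> b ->
        enorm (grad (fine \o phi) (xs k)) @[k --> \oo] --> +oo].

Definition cond_I phi : Prop :=
  exists h : R -> \bar R,
  let hs : R -> R := fine \o conjugate *%R h in
  [/\ (forall t, (0 <= h t)%E) /\ (forall x, phi x = h (enorm x)),
      (forall y z : R, 0 < y -> y <= z -> derive1 hs z / z <= derive1 hs y / y),
      (exists2 C2 : R, 0 <= C2 & y * derive1 (derive1 hs) y @[y --> +oo] --> C2) &
      (forall s : {poly R}, derive1 hs s.[y] / y @[y --> +oo] --> (0 : R))].

Definition anisotropic_smooth2 phi (L Lbar : R) (g : 'rV[R]_d -> R) : Prop :=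
  forall x,
    lambda_max (hess (conj_fun phi) (Lbar^-1 *: grad g x) *m hess g x)
      <= L * Lbar.

End ReferenceFunctions.

Section BurerMonteiro.
Context {R : realType} {n r : nat}.
Implicit Types (C : 'M[R]_n) (x : 'rV[R]_(n * r)).

(* [vec_mx] is row-major, so the rows of V are the consecutive blocks of x. *)
Definition BM_factor x : 'M[R]_(n, r) := vec_mx x.

Definition BM_objective C x : R :=
  - inner C (BM_factor x *m (BM_factor x)^T).

Definition BM_constraint x : 'rV[R]_n :=
  diagv (BM_factor x *m (BM_factor x)^T) - const_mx 1.

Definition BM_auglag C (beta : R) x (y : 'rV[R]_n) : R :=
  BM_objective C x + inner (BM_constraint x) y
    + beta / 2 * enorm (BM_constraint x) ^+ 2.

End BurerMonteiro.

(* Main.v *)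
Require Import Defs.
From mathcomp Require Import all_boot all_order all_algebra.
From mathcomp Require Import all_classical all_reals all_analysis.
From mathcomp Require Import ring lra.
Import Order.TTheory GRing.Theory Num.Theory.
Import numFieldNormedType.Exports.
Local Open Scope classical_set_scope.
Local Open Scope ring_scope.
Set Implicit Arguments.
Unset Strict Implicit.
Unset Printing Implicit Defensive.

(** The augmented Lagrangian [g] is a quartic polynomial whose leading part
[beta / 2 * \sum_i |x_i|^4] is coercive. Two growth rates in [rho := enorm x]
decide everything: the Hessian is at most quadratic in [rho] ([hess_growth]),
while by Euler's identity the gradient is at least cubic
([enorm_grad_BM_auglag_ge]).

(i) Since [rho ^+ 2] is eventually below any multiple of [rho ^+ 3], the Hessian
is dominated by [L1] times the gradient outside a ball
([quartic_L0L1_smooth]).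

(ii) Write [hs] for the conjugate of the kernel [h]. The conjugate of [phi] is
[hs] of the norm ([conj_fun_isotropic]) and strong convexity of [phi] makes it
semiconcave ([conj_fun_semiconcave]). A function that is both convex and
semiconcave is differentiable, and the gradient at [v] is [slope (enorm v) *: v]
with [slope t := hs' t / t] ([derive_conj_fun]). As [hs'] is nondecreasing and
the slope is nonincreasing, the slope is Lipschitz with a constant of the order
of [slope t / t] at [t] ([slope_lipschitz]); this bounds the entries of the
Hessian of the conjugate by [2 * slope (enorm v / 2)]
([hess_conj_fun_slope]), and by a constant everywhere ([hess_conj_fun_le]). At
[v := Lbar^-1 *: grad g x], of norm at least of order [rho ^+ 3], the product of
both Hessians is therefore of order [slope ((c * rho) ^+ 3) * rho ^+ 2], that
is [hs' (y ^+ 3) / y] with [y := c * rho] up to a constant, which tends to 0 by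
the growth condition on [hs'] for the polynomial ['X^3]
([quartic_anisotropic_smooth]). Eigenvalues of a product of matrices are bounded
by the entries of the factors ([lambda_max_mulmx_le]). *)

(** * Euclidean norm, spectral norm and eigenvalue bounds *)

Section EuclideanNorm.
Context {R : realType}.

Lemma innerE m n (X Y : 'M[R]_(m, n)) :
  inner X Y = \sum_i \sum_j X i j * Y i j.
Proof.
rewrite /inner /mxtrace exchange_big /=; apply: eq_bigr => j _.
by rewrite mxE; apply: eq_bigr => i _; rewrite mxE.
Qed.

Lemma inner_rowE d (u v : 'rV[R]_d) : inner u v = \sum_i u 0 i * v 0 i.
Proof. by rewrite innerE big_ord1. Qed.

Lemma innerDr d (u v w : 'rV[R]_d) : inner u (v + w) = inner u v + inner u w.
Proof.
rewrite !inner_rowE -big_split; apply: eq_bigr => i _ /=.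
by rewrite mxE mulrDr.
Qed.

Lemma innerDl d (u v w : 'rV[R]_d) : inner (u + v) w = inner u w + inner v w.
Proof.
rewrite !inner_rowE -big_split; apply: eq_bigr => i _ /=.
by rewrite mxE mulrDl.
Qed.

Lemma innerNr d (u v : 'rV[R]_d) : inner u (- v) = - inner u v.
Proof.
by rewrite !inner_rowE -sumrN; apply: eq_bigr => i _; rewrite mxE mulrN.
Qed.

Lemma innerZl d (a : R) (u v : 'rV[R]_d) : inner (a *: u) v = a * inner u v.
Proof.
by rewrite !inner_rowE mulr_sumr; apply: eq_bigr => i _; rewrite mxE mulrA.
Qed.

Lemma innerNl d (u v : 'rV[R]_d) : inner (- u) v = - inner u v.
Proof. by rewrite -scaleN1r innerZl mulN1r. Qed.

Lemma inner_ge0 m n (X : 'M[R]_(m, n)) : 0 <= inner X X.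
Proof.
rewrite innerE; apply: sumr_ge0 => i _; apply: sumr_ge0 => j _.
by rewrite -expr2 sqr_ge0.
Qed.

Lemma sqr_enorm m n (X : 'M[R]_(m, n)) : enorm X ^+ 2 = inner X X.
Proof. by rewrite sqr_sqrtr ?inner_ge0. Qed.

Lemma enorm_ge0 m n (X : 'M[R]_(m, n)) : 0 <= enorm X.
Proof. exact: sqrtr_ge0. Qed.

Lemma ler_entry_enorm m n (X : 'M[R]_(m, n)) i j : `|X i j| <= enorm X.
Proof.
rewrite -ler_sqr ?nnegrE ?enorm_ge0// sqr_enorm innerE real_normK ?num_real//.
rewrite (bigD1 i)//= (bigD1 j)//= -addrA expr2 lerDl addr_ge0//.
  by apply: sumr_ge0 => k _; rewrite -expr2 sqr_ge0.
apply: sumr_ge0 => l _; apply: sumr_ge0 => k _.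
by rewrite -expr2 sqr_ge0.
Qed.

Lemma enorm_le_sum m n (X : 'M[R]_(m, n)) :
  enorm X <= \sum_i \sum_j `|X i j|.
Proof.
have sum_ge0 : 0 <= \sum_i \sum_j `|X i j|.
  by apply: sumr_ge0 => i _; apply: sumr_ge0.
rewrite -ler_sqr ?nnegrE ?enorm_ge0// sqr_enorm innerE expr2 mulr_suml.
apply: ler_sum => i _; rewrite mulr_suml; apply: ler_sum => j _.
rewrite -expr2 -real_normK ?num_real// expr2 ler_wpM2l//.
rewrite (bigD1 i)//= (bigD1 j)//= -addrA lerDl addr_ge0//.
  by apply: sumr_ge0.
by apply: sumr_ge0 => k _; apply: sumr_ge0.
Qed.

Lemma enormZ m n (a : R) (X : 'M[R]_(m, n)) : enorm (a *: X) = `|a| * enorm X.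
Proof.
rewrite /enorm.
have -> : inner (a *: X) (a *: X) = a ^+ 2 * inner X X.
  rewrite !innerE mulr_sumr; apply: eq_bigr => i _.
  by rewrite mulr_sumr; apply: eq_bigr => j _; rewrite !mxE; ring.
by rewrite sqrtrM ?sqr_ge0// sqrtr_sqr.
Qed.

Lemma enorm_eq0 m n (X : 'M[R]_(m, n)) : enorm X = 0 -> X = 0.
Proof.
move=> X0; apply/matrixP => i j; rewrite mxE; apply/eqP.
by rewrite -normr_le0 -X0 ler_entry_enorm.
Qed.

Lemma enorm0 m n : enorm (0 : 'M[R]_(m, n)) = 0.
Proof. by rewrite -(scale0r 0) enormZ normr0 mul0r. Qed.

Lemma cauchy_schwarz d (u v : 'rV[R]_d) : inner u v <= enorm u * enorm v.
Proof.
have [u0|u0] := eqVneq (enorm u) 0.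
  rewrite u0 mul0r (enorm_eq0 u0) inner_rowE big1// => i _.
  by rewrite mxE mul0r.
have [v0|v0] := eqVneq (enorm v) 0.
  rewrite v0 mulr0 (enorm_eq0 v0) inner_rowE big1// => i _.
  by rewrite mxE mulr0.
have ugt0 : 0 < enorm u by rewrite lt_def u0 enorm_ge0.
have vgt0 : 0 < enorm v by rewrite lt_def v0 enorm_ge0.
have := inner_ge0 (enorm v *: u - enorm u *: v).
have -> : inner (enorm v *: u - enorm u *: v) (enorm v *: u - enorm u *: v) =
    enorm v ^+ 2 * inner u u - 2 * (enorm u * enorm v) * inner u v
      + enorm u ^+ 2 * inner v v.
  rewrite !inner_rowE !mulr_sumr -sumrB -big_split /=.
  by apply: eq_bigr => i _; rewrite !mxE; ring.
rewrite -!sqr_enorm => le0.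
have uv : 0 < enorm u * enorm v by rewrite mulr_gt0.
rewrite -(ler_pM2l uv); nra.
Qed.

Lemma enormD_sqr d (u v : 'rV[R]_d) :
  enorm (u + v) ^+ 2 = enorm u ^+ 2 + 2 * inner u v + enorm v ^+ 2.
Proof.
rewrite !sqr_enorm !inner_rowE mulr_sumr -!big_split /=.
by apply: eq_bigr => i _; rewrite !mxE; ring.
Qed.

Lemma ler_enormD d (u v : 'rV[R]_d) : enorm (u + v) <= enorm u + enorm v.
Proof.
rewrite -ler_sqr ?nnegrE ?addr_ge0 ?enorm_ge0// enormD_sqr.
have := cauchy_schwarz u v; nra.
Qed.

Lemma inner_delta d (u : 'rV[R]_d) (s : R) i :
  inner u (s *: delta_mx 0 i) = u 0 i * s.
Proof.
rewrite inner_rowE (bigD1 i)//= big1 ?addr0; last first.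
  by move=> j ji; rewrite !mxE (negbTE ji) andbF !mulr0.
by rewrite !mxE !eqxx mulr1.
Qed.

Lemma enorm_delta d (i : 'I_d) : enorm (delta_mx 0 i : 'rV[R]_d) = 1.
Proof.
by rewrite /enorm -[X in inner _ X]scale1r inner_delta mxE !eqxx mulr1 sqrtr1.
Qed.

Lemma ler_dist_enorm_shift d (v : 'rV[R]_d) (s : R) i :
  `|enorm (s *: delta_mx 0 i + v) - enorm v| <= `|s|.
Proof.
have := ler_enormD (s *: delta_mx 0 i) v.
have := ler_enormD (- s *: delta_mx 0 i) (s *: delta_mx 0 i + v).
rewrite addrA -scalerDl addNr scale0r add0r !enormZ enorm_delta mulr1 normrN.
by rewrite ler_distl => *; lra.
Qed.

(** Read the eigenvector equation at a coordinate of largest modulus. *)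
Lemma eigenvalue_mulmx_le d (M H : 'M[R]_d) (a bM bH : R) :
  (forall i j, `|M i j| <= bM) -> (forall i j, `|H i j| <= bH) ->
  eigenvalue (M *m H) a -> a <= d%:R ^+ 2 * (bM * bH).
Proof.
move=> leM leH /eigenvalueP[w wMH /rV0Pn[i0 wi0]].
pose k := [arg max_(i > i0) `|w 0 i|]%O.
have wk i : `|w 0 i| <= `|w 0 k| by rewrite /k; case: arg_maxP => // j _; exact.
have wk0 : 0 < `|w 0 k| by rewrite (lt_le_trans _ (wk i0))// normr_gt0.
have bM0 : 0 <= bM by rewrite (le_trans _ (leM k k)).
have leMH i j : `|(M *m H) i j| <= d%:R * (bM * bH).
  rewrite mxE (le_trans (ler_norm_sum _ _ _))//.
  rewrite (le_trans (y := \sum_(l < d) (bM * bH)))//.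
    by apply: ler_sum => l _; rewrite normrM ler_pM.
  by rewrite sumr_const card_ord mulr_natl.
apply: le_trans (ler_norm a) _; rewrite -(ler_pM2r wk0) -normrM.
have -> : a * w 0 k = (a *: w) 0 k by rewrite mxE.
rewrite -wMH mxE (le_trans (ler_norm_sum _ _ _))//.
rewrite (le_trans (y := \sum_(l < d) (`|w 0 k| * (d%:R * (bM * bH)))))//.
  by apply: ler_sum => l _; rewrite normrM ler_pM.
rewrite sumr_const card_ord -[leLHS]mulr_natl le_eqVlt; apply/orP; left.
by apply/eqP; ring.
Qed.

(** An entrywise bound loses a factor depending on [d] only, and the smoothness
constants are free to absorb it. *)
Lemma lambda_max_mulmx_le d (M H : 'M[R]_d) (bM bH : R) :
  0 <= bM -> 0 <= bH ->
  (forall i j, `|M i j| <= bM) -> (forall i j, `|H i j| <= bH) ->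
  lambda_max (M *m H) <= d%:R ^+ 2 * (bM * bH).
Proof.
move=> bM0 bH0 leM leH; rewrite /lambda_max.
have [->|/set0P ne0] := eqVneq [set a | eigenvalue (M *m H) a] set0.
  by rewrite sup0 !mulr_ge0 ?exprn_ge0.
by apply: ge_sup => // a; apply: eigenvalue_mulmx_le.
Qed.

Lemma specnorm_le d (H : 'M[R]_d) (b : R) :
  (forall i j, `|H i j| <= b) -> specnorm H <= d%:R ^+ 2 * b.
Proof.
move=> leH; apply: ge_sup.
  by by exists (enorm (H *m (0 : 'cV_d))), 0; rewrite //= enorm0.
move=> _ [v /= v1 <-]; rewrite (le_trans (enorm_le_sum _))//.
rewrite (le_trans (y := \sum_(i < d) \sum_(j < 1) (d%:R * b)))//; last first.
  under eq_bigr do rewrite big_ord1.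
  rewrite sumr_const card_ord -[leLHS]mulr_natl.
  by rewrite mulrA -expr2.
apply: ler_sum => i _; apply: ler_sum => j _.
rewrite mxE (le_trans (ler_norm_sum _ _ _))//.
rewrite (le_trans (y := \sum_(l < d) b))//; last first.
  by rewrite sumr_const card_ord mulr_natl.
apply: ler_sum => l _; rewrite normrM -[leRHS]mulr1 ler_pM//.
exact: le_trans (ler_entry_enorm _ _ _) v1.
Qed.

End EuclideanNorm.

(** * Polynomial functions on row vectors *)

Section PolynomialFunctions.
Context {R : realType} {d : nat}.
Implicit Types f g : 'rV[R]_d -> R.

(** The index bounds the total degree. The class is closed under the operations
that build the augmented Lagrangian and under partial derivatives, so that its
smoothness and the growth of its Hessian are read off its degree. *)
Inductive polynomial_fun : nat -> ('rV[R]_d -> R) -> Prop :=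
| polynomial_cst c : polynomial_fun 0 (fun=> c)
| polynomial_coord i : polynomial_fun 1 (fun x => x 0 i)
| polynomial_add k f g :
    polynomial_fun k f -> polynomial_fun k g ->
    polynomial_fun k (fun x => f x + g x)
| polynomial_mul k l f g :
    polynomial_fun k f -> polynomial_fun l g ->
    polynomial_fun (k + l) (fun x => f x * g x)
| polynomial_widen k l f :
    (k <= l)%N -> polynomial_fun k f -> polynomial_fun l f.

Lemma polynomial_sum (I : Type) (s : seq I) k (F : I -> 'rV[R]_d -> R) :
  (forall i, polynomial_fun k (F i)) ->
  polynomial_fun k (fun x => \sum_(i <- s) F i x).
Proof.
move=> polF; elim: s => [|i s IHs].
  apply: (@polynomial_widen 0) => //.
  have -> : (fun x => \sum_(i <- [::]) F i x) = (fun=> 0).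
    by apply/funext => x; rewrite big_nil.
  exact: polynomial_cst.
have -> : (fun x => \sum_(j <- i :: s) F j x) =
    (fun x => F i x + \sum_(j <- s) F j x).
  by apply/funext => x; rewrite big_cons.
exact: polynomial_add.
Qed.

Lemma polynomial_scale k f (c : R) :
  polynomial_fun k f -> polynomial_fun k (fun x => c * f x).
Proof.
move=> pf; rewrite -[k]add0n; apply: polynomial_mul => //.
exact: polynomial_cst.
Qed.

Lemma polynomial_fun_differentiable k f x :
  polynomial_fun k f -> differentiable f x.
Proof.
elim=> {k f} [c|i|k f g _ df _ dg|k l f g _ df _ dg|//].
- exact: differentiable_cst.
- exact: differentiable_coord.
- exact: differentiableD.
- exact: differentiableM.
Qed.

(** The vanishing clause handles degree 0, where [k.-1] does not drop: without
it the product rule would not lower the degree. *)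
Lemma polynomial_fun_derive k f (i : 'I_d) : polynomial_fun k f ->
  polynomial_fun k.-1 ('D_(delta_mx 0 i) f) /\
  (k = 0 -> forall x, 'D_(delta_mx 0 i) f x = 0).
Proof.
elim=> {k f} [c|j|k f g pf [Df f0] pg [Dg g0]
    |k l f g pf [Df f0] pg [Dg g0]|k l f kl pf [Df f0]].
- have -> : 'D_(delta_mx 0 i) (fun _ : 'rV[R]_d => c) = fun=> 0.
    by apply/funext => x; rewrite derive_cst.
  split; first exact: polynomial_cst.
  by move=> _ x; rewrite derive_cst.
- split=> //=.
  have -> : 'D_(delta_mx 0 i) (fun x : 'rV[R]_d => x 0 j) =
      fun=> (delta_mx 0 i : 'rV[R]_d) 0 j.
    apply/funext => x.
    have := @derive_mx R _ 1 d id x (delta_mx 0 i) (@derivable_id _ _ _ _).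
    by rewrite derive_id => /rowP/(_ j); rewrite [RHS]mxE => <-.
  exact: polynomial_cst.
- have DE x : 'D_(delta_mx 0 i) (fun x : 'rV[R]_d => f x + g x) x =
      'D_(delta_mx 0 i) f x + 'D_(delta_mx 0 i) g x.
    rewrite deriveD//; apply: diff_derivable.
      exact: polynomial_fun_differentiable pf.
    exact: polynomial_fun_differentiable pg.
  split; first by rewrite (funext DE); exact: polynomial_add.
  by move=> k0 x; rewrite DE f0// g0// addr0.
- have DE x : 'D_(delta_mx 0 i) (fun x : 'rV[R]_d => f x * g x) x =
      f x * 'D_(delta_mx 0 i) g x + g x * 'D_(delta_mx 0 i) f x.
    rewrite deriveM//; apply: diff_derivable.
      exact: polynomial_fun_differentiable pf.
    exact: polynomial_fun_differentiable pg.
  split.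
    rewrite (funext DE); apply: polynomial_add.
      case: l pg Dg g0 => [|l] pg Dg g0.
        apply: (@polynomial_widen 0) => //.
        have -> : (fun x => f x * 'D_(delta_mx 0 i) g x) = (fun=> 0).
          by apply/funext => x; rewrite g0// mulr0.
        exact: polynomial_cst.
      by rewrite addnS /=; apply: polynomial_mul.
    case: k pf Df f0 => [|k] pf Df f0.
      apply: (@polynomial_widen 0) => //.
      have -> : (fun x => g x * 'D_(delta_mx 0 i) f x) = (fun=> 0).
        by apply/funext => x; rewrite f0// mulr0.
      exact: polynomial_cst.
    by rewrite addnC addnS /=; apply: polynomial_mul.
  move/eqP; rewrite addn_eq0 => /andP[/eqP k0 /eqP l0] x.
  by rewrite DE f0// g0// !mulr0 addr0.
- split; last first.
    by move=> l0; apply: f0; apply/eqP; rewrite -leqn0; rewrite l0 in kl.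
  by apply: polynomial_widen Df; rewrite -!subn1 leq_sub2r.
Qed.

Lemma polynomial_fun_growth k f : polynomial_fun k f ->
  exists2 B : R, 0 <= B & forall x, `|f x| <= B * (1 + enorm x) ^+ k.
Proof.
have rho1 (x : 'rV[R]_d) : 1 <= 1 + enorm x by rewrite lerDl enorm_ge0.
have rho0 (x : 'rV[R]_d) : 0 <= 1 + enorm x by rewrite addr_ge0 ?enorm_ge0.
elim=> {k f} [c|i|k f g _ [B B0 fB] _ [B' B'0 gB']
    |k l f g _ [B B0 fB] _ [B' B'0 gB']|k l f kl _ [B B0 fB]].
- by exists `|c| => // x; rewrite expr0 mulr1.
- exists 1 => // x; rewrite mul1r expr1 (le_trans (ler_entry_enorm x 0 i))//.
  by rewrite lerDr.
- exists (B + B'); first by rewrite addr_ge0.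
  by move=> x; rewrite mulrDl (le_trans (ler_normD _ _))// lerD.
- exists (B * B'); first by rewrite mulr_ge0.
  by move=> x; rewrite normrM exprD mulrACA ler_pM.
- exists B => // x; rewrite (le_trans (fB x))// ler_wpM2l//.
  exact: ler_weXn2l.
Qed.

Lemma row_delta_sumE (u : 'rV[R]_d) : u = \sum_i u 0 i *: delta_mx 0 i.
Proof.
apply/rowP => j; rewrite summxE (bigD1 j)//= big1 ?addr0 => [|i ij].
  by rewrite !mxE !eqxx mulr1.
by rewrite !mxE eq_sym (negbTE ij) andbF mulr0.
Qed.

Lemma polynomial_fun_C2 k f : polynomial_fun k f -> C2_on setT f.
Proof.
move=> pf x _.
have pDf i := (polynomial_fun_derive i pf).1.
have pDDf i j := (polynomial_fun_derive i (pDf j)).1.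
split.
- exact: polynomial_fun_differentiable pf.
- have -> : grad f = \sum_i (fun x =>
      'D_(delta_mx 0 i) f x *: (delta_mx 0 i : 'rV[R]_d)).
    apply/funext => z; rewrite fct_sumE [LHS]row_delta_sumE.
    by apply: eq_bigr => i _; rewrite mxE.
  apply: differentiable_sum => i; apply: differentiableZl.
  exact: polynomial_fun_differentiable (pDf i).
- have -> : hess f = \sum_i \sum_j (fun x =>
     'D_(delta_mx 0 i) ('D_(delta_mx 0 j) f) x *: (delta_mx i j : 'M[R]_d)).
    apply/funext => z; rewrite fct_sumE [LHS]matrix_sum_delta.
    apply: eq_bigr => i _; rewrite fct_sumE; apply: eq_bigr => j _.
    by rewrite mxE.
  apply: differentiable_continuous.
  apply: differentiable_sum => i; apply: differentiable_sum => j.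
  apply: differentiableZl; exact: polynomial_fun_differentiable (pDDf i j).
Qed.

End PolynomialFunctions.

(** * Growth of the gradient of the augmented Lagrangian *)

Section EulerIdentity.
Context {R : realType} {d : nat}.
Implicit Types f : 'rV[R]_d -> R.

Lemma inner_grad f x v : differentiable f x -> inner (grad f x) v = 'D_v f x.
Proof.
move=> df; rewrite inner_rowE [in RHS](row_delta_sumE v) deriveE// linear_sum.
apply: eq_bigr => i _ /=.
by rewrite linearZ /= mxE deriveE// mulrC.
Qed.

(** Euler's identity, obtained by differentiating [f] along its own ray. *)
Lemma inner_grad_even_quartic f x (a b c : R) :
  differentiable f x -> (forall t, f (t *: x) = a + t ^+ 2 * b + t ^+ 4 * c) ->
  inner (grad f x) x = 2 * b + 4 * c.
Proof.
move=> df fx; rewrite inner_grad//.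
pose p := fun t : R => a + t ^+ 2 * b + t ^+ 4 * c.
have -> : 'D_x f x = 'D_1 p 1.
  rewrite /derive; set F := (X in lim (X @ _)); set G := (X in _ = lim (X @ _)).
  suff -> : F = G by [].
  apply/funext => h; rewrite /F /G /=.
  rewrite -[X in f (_ + X)](scale1r x) -scalerDl fx.
  rewrite -[X in _ - f X](scale1r x) fx.
  by rewrite /p [h *: 1]mulr1.
have : is_derive (1 : R) 1 p (2 * b + 4 * c).
  have -> : p = cst a + (b *: (id ^+ 2 : R -> R) + c *: (id ^+ 4 : R -> R)).
    apply/funext => t; rewrite /p /= -addrA.
    by rewrite [t ^+ 2 * b]mulrC [t ^+ 4 * c]mulrC.
  have dX n : is_derive (1 : R) 1 (id ^+ n : R -> R) n%:R.
    by apply: is_derive_eq; rewrite expr1n mulr1 [_ *: _]mulr1.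
  apply: (is_derive_eq (is_deriveD (is_derive_cst a _ _)
    (is_deriveD (is_deriveZ b (dX 2)) (is_deriveZ c (dX 4))))).
  by rewrite add0r [b *: _]mulrC [c *: _]mulrC.
by case=> _ ->.
Qed.

End EulerIdentity.

Section AugmentedLagrangian.
Context {R : realType} {n r : nat}.
Variables (C : 'M[R]_n) (beta : R) (y : 'rV[R]_n).
Implicit Types x : 'rV[R]_(n * r).

Definition row_sqnorm x (i : 'I_n) : R := \sum_(k < r) BM_factor x i k ^+ 2.

Definition BM_quadratic x : R :=
  - (\sum_i \sum_j C i j * \sum_k BM_factor x i k * BM_factor x j k)
  + \sum_i (y 0 i - beta) * row_sqnorm x i.

Definition BM_quartic x : R := beta / 2 * \sum_i row_sqnorm x i ^+ 2.

Definition BM_constant : R := \sum_i (beta / 2 - y 0 i).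

(** The homogeneous decomposition behind the growth of the gradient: the penalty
supplies the quartic part, whose sign does not depend on [C] or [y]. *)
Lemma BM_auglagE x :
  BM_auglag C beta x y = BM_constant + BM_quadratic x + BM_quartic x.
Proof.
rewrite /BM_auglag /BM_objective sqr_enorm !inner_rowE innerE.
rewrite /BM_constant /BM_quadratic /BM_quartic !mulr_sumr.
have -> : \sum_i \sum_j C i j * (BM_factor x *m (BM_factor x)^T) i j =
    \sum_i \sum_j C i j * \sum_k BM_factor x i k * BM_factor x j k.
  apply: eq_bigr => i _; apply: eq_bigr => j _; rewrite mxE.
  by congr (_ * _); apply: eq_bigr => k _; rewrite [_^T _ _]mxE.
rewrite [X in _ = X + _]addrCA -[LHS]addrA -[RHS]addrA; congr (_ + _).
rewrite -!big_split /=.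
apply: eq_bigr => i _; rewrite !mxE.
have -> : \sum_j BM_factor x i j * (BM_factor x)^T j i = row_sqnorm x i.
  by apply: eq_bigr => k _; rewrite [_^T _ _]mxE expr2.
by field.
Qed.

Lemma BM_factorZ t x i k : BM_factor (t *: x) i k = t * BM_factor x i k.
Proof. by rewrite /BM_factor linearZ mxE. Qed.

Lemma row_sqnormZ t x i : row_sqnorm (t *: x) i = t ^+ 2 * row_sqnorm x i.
Proof.
rewrite /row_sqnorm mulr_sumr; apply: eq_bigr => k _.
by rewrite BM_factorZ exprMn.
Qed.

Lemma BM_quadraticZ t x : BM_quadratic (t *: x) = t ^+ 2 * BM_quadratic x.
Proof.
rewrite /BM_quadratic mulrDr mulrN !mulr_sumr; congr (- _ + _).
  apply: eq_bigr => i _; rewrite mulr_sumr; apply: eq_bigr => j _.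
  rewrite [RHS]mulrCA [X in _ = _ * X]mulr_sumr; congr (_ * _).
  apply: eq_bigr => k _.
  by rewrite !BM_factorZ; ring.
by apply: eq_bigr => i _; rewrite row_sqnormZ mulrCA.
Qed.

Lemma BM_quarticZ t x : BM_quartic (t *: x) = t ^+ 4 * BM_quartic x.
Proof.
rewrite /BM_quartic [RHS]mulrCA [in RHS]mulr_sumr; congr (_ * _).
by apply: eq_bigr => i _; rewrite row_sqnormZ; ring.
Qed.

Lemma polynomial_BM_factor i k :
  polynomial_fun 1 (fun x => BM_factor x i k).
Proof.
have -> : (fun x => BM_factor x i k) = (fun x => x 0 (mxvec_index i k)).
  by apply/funext => x; rewrite -[in RHS](vec_mxK x) mxvecE.
exact: polynomial_coord.
Qed.

Lemma polynomial_row_sqnorm i : polynomial_fun 2 (row_sqnorm ^~ i).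
Proof.
apply: polynomial_sum => k.
by have := polynomial_mul (polynomial_BM_factor i k) (polynomial_BM_factor i k).
Qed.

Lemma polynomial_BM_quadratic : polynomial_fun 2 BM_quadratic.
Proof.
apply: polynomial_add.
  have -> : (fun x => - (\sum_i \sum_j C i j *
        \sum_k BM_factor x i k * BM_factor x j k)) =
      (fun x => -1 * (\sum_i \sum_j C i j *
        \sum_k BM_factor x i k * BM_factor x j k)).
    by apply/funext => x; rewrite mulN1r.
  apply: polynomial_scale; apply: polynomial_sum => i.
  apply: polynomial_sum => j; apply: polynomial_scale.
  apply: polynomial_sum => k.
  exact: (polynomial_mul (polynomial_BM_factor i k) (polynomial_BM_factor j k)).
apply: polynomial_sum => i; apply: polynomial_scale.
exact: polynomial_row_sqnorm.
Qed.

Lemma polynomial_BM_auglag :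
  polynomial_fun 4 (fun x => BM_auglag C beta x y).
Proof.
rewrite (funext BM_auglagE); apply: polynomial_add.
  apply: polynomial_add.
    exact: polynomial_widen (polynomial_cst _).
  exact: polynomial_widen polynomial_BM_quadratic.
apply: polynomial_scale; apply: polynomial_sum => i.
exact: (polynomial_mul (polynomial_row_sqnorm i) (polynomial_row_sqnorm i)).
Qed.

Lemma sqr_enorm_rows x : enorm x ^+ 2 = \sum_i row_sqnorm x i.
Proof.
rewrite sqr_enorm inner_rowE pair_bigA /=.
rewrite (reindex _ (curry_mxvec_bij _ _)) /=; apply: eq_bigr => -[i k] _ /=.
by rewrite -(vec_mxK x) mxvecE vec_mxK expr2.
Qed.

Lemma sqr_sum_le (q : 'I_n -> R) :
  (\sum_i q i) ^+ 2 <= n%:R * \sum_i q i ^+ 2.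
Proof.
have -> : n%:R * \sum_i q i ^+ 2 =
    \sum_i \sum_j (q i ^+ 2 + q j ^+ 2) / 2.
  under [RHS]eq_bigr do rewrite -mulr_suml big_split /= sumr_const card_ord.
  rewrite -mulr_suml big_split /= sumr_const card_ord sumrMnl.
  by rewrite mulr_natl mulrDl -splitr.
rewrite expr2 mulr_suml; apply: ler_sum => i _; rewrite mulr_sumr.
apply: ler_sum => j _; have := sqr_ge0 (q i - q j); nra.
Qed.

(** By Euler's identity the radial component of the gradient is
[(4 * quartic + 2 * quadratic) / enorm x]; the quartic part dominates, because
the sum of the squared [row_sqnorm] is at least [enorm x ^+ 4 / n]. *)
Lemma enorm_grad_BM_auglag_ge : 0 < beta ->
  exists2 kappa : R, 0 < kappa & exists2 R0 : R, 1 <= R0 &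
    forall x, R0 <= enorm x ->
      kappa * enorm x ^+ 3 <= enorm (grad (fun x => BM_auglag C beta x y) x).
Proof.
move=> beta0.
have [B B0 leB] := polynomial_fun_growth polynomial_BM_quadratic.
(* [n.+1] rather than [n] keeps [kappa] positive when [n = 0]. *)
pose kappa := beta / n.+1%:R.
have k0 : 0 < kappa by rewrite divr_gt0.
exists kappa => //; exists (1 + 8 * B / kappa).
  by rewrite lerDl divr_ge0// ?mulr_ge0// ltW.
move=> x; set rho := enorm x => rhoge.
have rho1 : 1 <= rho.
  by rewrite (le_trans _ rhoge)// lerDl divr_ge0// ?mulr_ge0// ltW.
have rho0 : 0 < rho by rewrite (lt_le_trans _ rho1).
have krho : 8 * B <= kappa * rho.
  rewrite -ler_pdivrMl// mulrC (le_trans _ rhoge)// lerDr//.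
have := cauchy_schwarz (grad (fun x => BM_auglag C beta x y) x) x.
rewrite (@inner_grad_even_quartic _ _ _ x
  BM_constant (BM_quadratic x) (BM_quartic x)); last 2 first.
- exact: polynomial_fun_differentiable polynomial_BM_auglag.
- by move=> t; rewrite BM_auglagE BM_quadraticZ BM_quarticZ.
rewrite -/rho => le_grad; rewrite -(ler_pM2r rho0); apply: le_trans le_grad.
have q4 : 2 * kappa * rho ^+ 4 <= 4 * BM_quartic x.
  have := sqr_sum_le (row_sqnorm x); rewrite -sqr_enorm_rows -/rho -exprM.
  rewrite /BM_quartic => le4.
  have sum0 : 0 <= \sum_i row_sqnorm x i ^+ 2.
    by apply: sumr_ge0 => i _; exact: sqr_ge0.
  have {}le4 : rho ^+ 4 <= n.+1%:R * \sum_i row_sqnorm x i ^+ 2.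
    by apply: le_trans le4 _; rewrite ler_wpM2r// ler_nat.
  have -> : 4 * (beta / 2 * \sum_i row_sqnorm x i ^+ 2) =
    2 * kappa * (n.+1%:R * \sum_i row_sqnorm x i ^+ 2).
    by rewrite /kappa; field.
  by rewrite ler_pM2l// mulr_gt0.
have q2 : - (4 * B * rho ^+ 2) <= BM_quadratic x.
  have := leB x; rewrite ler_norml -/rho => /andP[+ _].
  apply: le_trans; rewrite lerN2.
  have : (1 + rho) ^+ 2 <= 4 * rho ^+ 2 by nra.
  by move/(ler_wpM2l B0); rewrite [X in _ <= X -> _]mulrCA mulrA.
have : 8 * B * rho ^+ 2 <= kappa * rho ^+ 4.
  apply: (@le_trans _ _ (kappa * rho ^+ 3)).
    rewrite (_ : kappa * rho ^+ 3 = kappa * rho * rho ^+ 2); last by ring.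
    by rewrite ler_wpM2r// sqr_ge0.
  by rewrite ler_pM2l// ler_weXn2l.
have -> : kappa * rho ^+ 3 * rho = kappa * rho ^+ 4 by ring.
by move: q4 q2; clear; lra.
Qed.

End AugmentedLagrangian.

(** * Conjugates of isotropic strongly convex functions *)

Section DerivativeBounds.
Context {R : realType}.

(** Differentiability read off a two-sided quadratic estimate: this is how the
derivatives of the conjugate are obtained, from convexity on one side and
semiconcavity on the other. *)
Lemma is_derive_quadratic (V : normedModType R) (f : V -> R) (v e : V)
    (m K : R) :
  (forall k : R, 0 <= f (k *: e + v) - f v - m * k <= K * k ^+ 2) ->
  is_derive v e f m.
Proof.
move=> fm; have K0 : 0 <= K.
  by have /andP[lo /(le_trans lo)] := fm 1; rewrite expr1n mulr1.
have fd : h^-1 *: ((f \o shift v) (h *: e) - f v) @[h --> 0^'] --> m.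
  apply/cvgrPdist_le => eps eps0; near=> h.
  have h0 : h != 0 by near: h; exact: nbhs_dnbhs_neq.
  have hK : `|h| < eps / (K + 1).
    by near: h; apply: dnbhs0_lt; rewrite divr_gt0// ltr_wpDl.
  have /andP[lo up] := fm h; rewrite /=.
  have -> : m - h^-1 *: (f (h *: e + v) - f v) =
      - (h^-1 * (f (h *: e + v) - f v - m * h)).
    by rewrite /GRing.scale /=; field.
  rewrite normrN normrM normfV ler_pdivrMl ?normr_gt0// ger0_norm//.
  apply: (le_trans up); rewrite -real_normK ?num_real// expr2 mulrCA.
  rewrite ler_wpM2l//; move: hK; rewrite ltr_pdivlMr ?ltr_wpDl// => /ltW.
  by apply: le_trans; rewrite mulrDr mulr1 mulrC lerDl.
by apply: DeriveDef; [apply/cvg_ex; exists m|exact/cvg_lim].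
Unshelve. all: by end_near. Qed.

(** The estimate survives where the limit of the difference quotients does not
exist: the directional derivative is then [0] by convention. *)
Lemma ler_norm_derive (V : normedModType R) (f : V -> R) (v e : V)
    (K delta : R) :
  0 <= K -> 0 < delta ->
  (forall s : R, s != 0 -> `|s| <= delta ->
     `|f (s *: e + v) - f v| <= K * `|s|) ->
  `|'D_e f v| <= K.
Proof.
move=> K0 d0 fK; rewrite /derive.
set q := (X in lim (X @ _)).
have [cq|ncq] := pselect (cvg (q @ 0^')); last first.
  rewrite /lim /lim_in getPN ?normr0// => l ql.
  by apply: ncq; apply/cvg_ex; exists l.
have bq : \forall h \near 0^', `|q h| <= K.
  near=> h; have h0 : h != 0 by near: h; exact: nbhs_dnbhs_neq.
  rewrite /q normrM normfV ler_pdivrMl ?normr_gt0// mulrC; apply: fK => //.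
  by near: h; exact: dnbhs0_le.
rewrite ler_norml; apply/andP; split.
  by apply: limr_ge => //; apply: filterS bq => h; rewrite ler_norml => /andP[].
by apply: limr_le => //; apply: filterS bq => h; rewrite ler_norml => /andP[].
Unshelve. all: by end_near. Qed.

(** The slope is the supremum of the left difference quotients; semiconcavity
forces the right ones to have the same limit. *)
Lemma convex_semiconcave_derive (psi : R -> R) (y K : R) :
  (forall k l, 0 < k -> 0 < l ->
     (k + l) * psi y <= k * psi (y + l) + l * psi (y - k)) ->
  (forall k, psi (y + k) + psi (y - k) <= 2 * psi y + K * k ^+ 2) ->
  exists2 m, is_derive y 1 psi m & forall z, psi y + m * (z - y) <= psi z.
Proof.
move=> conv semi.
pose S := [set (psi y - psi (y - k)) / k | k in [set k | 0 < k]].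
have leS k l : 0 < k -> 0 < l ->
    (psi y - psi (y - k)) / k <= (psi (y + l) - psi y) / l.
  move=> k0 l0; rewrite ler_pdivrMr// mulrAC ler_pdivlMr//.
  by have := conv k l k0 l0; lra.
have S_ub : has_ubound S.
  by exists ((psi (y + 1) - psi y) / 1) => _ [k k0 <-]; exact: leS.
pose m := sup S.
have sub k : psi y + m * k <= psi (y + k).
  have [k0|k0|->] := ltgtP k 0; last by rewrite mulr0 !addr0.
    have : (psi y - psi (y - - k)) / - k <= m.
      by apply: ub_le_sup => //; exists (- k); rewrite //= oppr_gt0.
    by rewrite opprK ler_pdivrMr ?oppr_gt0//; lra.
  have : m <= (psi (y + k) - psi y) / k.
    apply: ge_sup; first by exists ((psi y - psi (y - 1)) / 1), 1 => /=.
    by move=> _ [l l0 <-]; exact: leS.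
  by rewrite ler_pdivlMr//; lra.
exists m; last by move=> z; rewrite (le_trans (sub _))// addrC subrK.
apply: (@is_derive_quadratic _ _ _ _ _ K) => k; rewrite [k *: 1]mulr1 (addrC k).
have := sub k; have := sub (- k); have := semi k; rewrite mulrN => *.
by apply/andP; split; lra.
Qed.

End DerivativeBounds.

Section Conjugates.
Context {R : realType}.

(** The conjugate as a supremum over the finite values of [f] only, which keeps
the rest of the argument inside the real numbers. *)
Lemma fine_conjugateP (T : Type) (pair : T -> T -> R) (f : T -> \bar R) (y : T)
    (c : R) :
  (forall x, (0 <= f x)%E) -> (exists x a, f x = a%:E) ->
  (forall x a, f x = a%:E -> pair x y - a <= c) ->
  (forall x a, f x = a%:E -> pair x y - a <= fine (conjugate pair f y)) /\
  (forall c', (forall x a, f x = a%:E -> pair x y - a <= c') ->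
     fine (conjugate pair f y) <= c').
Proof.
move=> f0 [x0 [a0 fx0]] fc.
have le_conj x a : f x = a%:E -> ((pair x y - a)%:E <= conjugate pair f y)%E.
  by move=> fx; apply: ereal_sup_ubound; exists x => //; rewrite fx EFinB.
have conj_le c' : (forall x a, f x = a%:E -> pair x y - a <= c') ->
    (conjugate pair f y <= c'%:E)%E.
  move=> fc'; apply: ge_ereal_sup => _ [x _ <-].
  case fx : (f x) => [a| |]; last by have := f0 x; rewrite fx.
    by rewrite -EFinB lee_fin; exact: fc'.
  by rewrite leNye.
have conj_fin : conjugate pair f y \is a fin_num.
  rewrite fin_numE -ltNye -ltey (le_lt_trans (conj_le c fc)) ?ltry// andbT.
  by rewrite (lt_le_trans _ (le_conj _ _ fx0))// ltNyr.
split=> [x a fx|c' fc'].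
  by rewrite -lee_fin fineK//; exact: le_conj.
by rewrite -lee_fin fineK//; exact: conj_le.
Qed.

End Conjugates.

Section IsotropicConjugate.
Context {R : realType} {d : nat}.
Variables (phi : 'rV[R]_d -> \bar R) (h : R -> \bar R) (mu : R).
(** A coordinate: it provides a unit vector, hence excludes dimension 0. *)
Variable i : 'I_d.
Hypothesis mu_gt0 : 0 < mu.
Hypothesis phi_convex : forall (x z : 'rV[R]_d) (t : R), 0 <= t <= 1 ->
  (phi (t *: x + (1 - t) *: z)%R
     + (mu / 2 * (t * (1 - t)) * enorm (x - z) ^+ 2)%:E
   <= t%:E * phi x + (1 - t)%:E * phi z)%E.
Hypothesis phi0 : phi 0 = 0%E.
Hypothesis h_ge0 : forall t, (0 <= h t)%E.
Hypothesis phiE : forall x, phi x = h (enorm x).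

Local Notation e := (delta_mx 0 i : 'rV[R]_d).
Local Notation F := (conj_fun phi).
Local Notation hs := (fine \o conjugate *%R h).
Local Notation slope t := (derive1 hs t / t).

Let phi_ge0 x : (0 <= phi x)%E. Proof. by rewrite phiE. Qed.

Let h0 : h 0 = 0%E. Proof. by rewrite -phi0 phiE enorm0. Qed.

Lemma phi_midpoint x z a b : phi x = a%:E -> phi z = b%:E ->
  exists2 c, phi (2^-1 *: (x + z)) = c%:E &
    2 * c + mu / 4 * enorm (x - z) ^+ 2 <= a + b.
Proof.
move=> phix phiz.
have half01 : 0 <= (2^-1 : R) <= 1 by apply/andP; split; lra.
have := phi_convex x z half01.
have -> : 1 - 2^-1 = 2^-1 :> R by lra.
rewrite -scalerDr phix phiz -!EFinM -EFinD.
have := phi_ge0 (2^-1 *: (x + z)).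
case: (phi _) => [c| |]//= _; rewrite -EFinD lee_fin => le_c.
by exists c => //; lra.
Qed.

(** The midpoint inequality against the minimiser 0. *)
Lemma phi_growth x a : phi x = a%:E -> mu / 4 * enorm x ^+ 2 <= a.
Proof.
move=> phix; have [c phic] := phi_midpoint phix phi0; rewrite subr0 addr0.
by have := phi_ge0 (2^-1 *: (x + 0)); rewrite phic lee_fin => *; lra.
Qed.

Lemma young a b : a * b - mu / 4 * a ^+ 2 <= b ^+ 2 / mu.
Proof.
rewrite ler_pdivlMr//; have := sqr_ge0 (b - mu / 2 * a).
by rewrite sqrrB exprMn; lra.
Qed.

Lemma conj_funP v :
  (forall x a, phi x = a%:E -> inner x v - a <= F v) /\
  (forall c, (forall x a, phi x = a%:E -> inner x v - a <= c) -> F v <= c).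
Proof.
apply: (@fine_conjugateP _ _ _ _ _ (enorm v ^+ 2 / mu)) => //.
  by exists 0, 0.
move=> x a phix; have := phi_growth phix; have := cauchy_schwarz x v.
by have := young (enorm x) (enorm v); lra.
Qed.

Lemma kernel_growth s a : 0 <= s -> h s = a%:E -> mu / 4 * s ^+ 2 <= a.
Proof.
move=> s0 hsa; have ns : enorm (s *: e) = s.
  by rewrite enormZ enorm_delta mulr1 ger0_norm.
by rewrite -{1}ns; apply: phi_growth; rewrite phiE ns.
Qed.

Lemma kernel_young s t a : 0 <= t -> h s = a%:E -> s * t - a <= t ^+ 2 / mu.
Proof.
move=> t0 hsa; have [s0|s0] := leP 0 s.
  by have := kernel_growth s0 hsa; have := young s t; lra.
have a0 : 0 <= a by rewrite -lee_fin -hsa.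
have st0 : s * t <= 0 by rewrite mulr_le0_ge0// ltW.
have : 0 <= t ^+ 2 / mu by rewrite divr_ge0 ?sqr_ge0// ltW.
by lra.
Qed.

Lemma kernel_conjP t : 0 <= t ->
  (forall s a, h s = a%:E -> s * t - a <= hs t) /\
  (forall c, (forall s a, h s = a%:E -> s * t - a <= c) -> hs t <= c).
Proof.
move=> t0; apply: (@fine_conjugateP _ _ _ _ _ (t ^+ 2 / mu)) => //.
  by exists 0, 0.
by move=> s a; exact: kernel_young.
Qed.

(** Cauchy-Schwarz is attained on the ray through [v]; negative arguments of [h]
do not contribute to the supremum, as [h 0 = 0] and [h] is nonnegative. *)
Lemma conj_fun_isotropic v : F v = hs (enorm v).
Proof.
have [leF Fle] := conj_funP v; have [leh hle] := kernel_conjP (enorm_ge0 v).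
apply/eqP; rewrite eq_le; apply/andP; split.
  apply: Fle => x a; rewrite phiE => /leh; apply: le_trans.
  by rewrite lerD2r cauchy_schwarz.
have F0 : 0 <= F v.
  have := leF 0 0 phi0; rewrite subr0; apply: le_trans.
  by rewrite inner_rowE big1// => j _; rewrite mxE mul0r.
apply: hle => s a hsa; have a0 : 0 <= a by rewrite -lee_fin -hsa.
have [s0|s0] := leP s 0.
  rewrite (le_trans _ F0)// subr_le0 (le_trans _ a0)//.
  by rewrite mulr_le0_ge0// enorm_ge0.
have [v0|v0] := eqVneq (enorm v) 0.
  by rewrite v0 mulr0 sub0r (le_trans _ F0)// oppr_le0.
have := leF ((s / enorm v) *: v) a.
have c0 : 0 <= s / enorm v by rewrite divr_ge0 ?enorm_ge0// ltW.
rewrite phiE enormZ (ger0_norm c0) divfK// => /(_ hsa).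
have -> : inner ((s / enorm v) *: v) v = s * enorm v.
  by rewrite innerZl -sqr_enorm; field.
by [].
Qed.

Lemma kernel_conj_ge0 t : 0 <= t -> 0 <= hs t.
Proof.
by move=> t0; have [+ _] := kernel_conjP t0 => /(_ 0 0 h0); rewrite mul0r subr0.
Qed.

Lemma kernel_conj_le t : 0 <= t -> hs t <= t ^+ 2 / mu.
Proof.
move=> t0; have [_] := kernel_conjP t0; apply=> s a; exact: kernel_young.
Qed.

(** Duality turns strong convexity of [phi] into semiconcavity: the midpoint of
two competitors [x] and [z] competes for the value at [v]. *)
Lemma conj_fun_semiconcave v w :
  F (v + w) + F (v - w) <= 2 * F v + enorm w ^+ 2 / mu.
Proof.
have [leF _] := conj_funP v.
rewrite -lerBrDr; have [_] := conj_funP (v + w); apply=> x a phix.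
rewrite lerBrDr addrC -lerBrDr; have [_] := conj_funP (v - w); apply=> z b phiz.
have [c phic le_c] := phi_midpoint phix phiz.
have := leF _ _ phic; have := cauchy_schwarz (x - z) w.
have := young (enorm (x - z)) (enorm w).
by rewrite innerZl !innerDl !innerDr innerNr innerNl; lra.
Qed.

(** Along a unit vector the conjugate is convex and semiconcave, hence
differentiable with its derivative as subgradient; for positive arguments it
agrees there with the conjugate of the kernel. *)
Lemma kernel_conj_subgradient y z : 0 < y -> 0 <= z ->
  hs y + derive1 hs y * (z - y) <= hs z.
Proof.
move=> y0 z0; pose psi s := F (s *: e).
have psiE s : psi s = hs `|s|.
  by rewrite /psi conj_fun_isotropic enormZ enorm_delta mulr1.
(* [psi] is even, hence defined on both sides of [y], whereas the conjugate of
     [h] is under control on nonnegative arguments only. *)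
have [m dm sub] : exists2 m, is_derive y 1 psi m &
    forall z, psi y + m * (z - y) <= psi z.
  apply: (@convex_semiconcave_derive _ _ _ mu^-1) => [k l k0 l0|k].
    have [leF _] := conj_funP ((y + l) *: e).
    have [leF' _] := conj_funP ((y - k) *: e).
    rewrite mulrC -ler_pdivlMr ?addr_gt0//.
    have [_] := conj_funP (y *: e); apply=> x a phix.
    rewrite ler_pdivlMr ?addr_gt0//.
    have := leF x a phix; have := leF' x a phix; rewrite !inner_delta.
    move=> /(ler_wpM2l (ltW l0)) + /(ler_wpM2l (ltW k0)).
    by rewrite -/(psi _) -/(psi _); lra.
  have := conj_fun_semiconcave (y *: e) (k *: e).
  rewrite -scalerDl -scalerBl enormZ enorm_delta mulr1 real_normK ?num_real//.
  by rewrite (mulrC mu^-1).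
have hsm : is_derive y 1 hs m.
  apply: near_eq_is_derive dm; near=> s; rewrite psiE ger0_norm//.
  by rewrite ltW//; near: s; exact: lt_nbhsr.
have -> : derive1 hs y = m by rewrite derive1E; case: hsm.
by have := sub z; rewrite !psiE !ger0_norm// ltW.
Unshelve. all: by end_near. Qed.

Lemma kernel_conj_derive_ge0 y : 0 < y -> 0 <= derive1 hs y.
Proof.
move=> y0; have := kernel_conj_subgradient y0 (lexx 0).
have := kernel_conj_ge0 (ltW y0); have := kernel_conj_le (lexx 0).
rewrite expr0n mul0r sub0r => *; rewrite -(pmulr_lge0 _ y0); lra.
Qed.

Lemma kernel_slope_ge0 y : 0 < y -> 0 <= slope y.
Proof. by move=> y0; rewrite divr_ge0 ?kernel_conj_derive_ge0// ltW. Qed.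

Lemma kernel_slope_le y : 0 < y -> slope y <= 4 / mu.
Proof.
move=> y0; have y20 : 0 <= 2 * y by rewrite mulr_ge0// ltW.
have := kernel_conj_subgradient y0 y20.
have := kernel_conj_ge0 (ltW y0); have := kernel_conj_le y20.
have -> : 2 * y - y = y by lra.
rewrite exprMn mulrAC => up lo sub.
rewrite ler_pdivrMr// -(ler_pM2r y0).
by rewrite (_ : 4 / mu * y * y = 2 ^+ 2 / mu * y ^+ 2); [lra|ring].
Qed.

Lemma kernel_conj_derive_nondecreasing a b : 0 < a -> a <= b ->
  derive1 hs a <= derive1 hs b.
Proof.
rewrite le_eqVlt => a0 /predU1P[->//|ab]; have b0 := lt_trans a0 ab.
have suba := kernel_conj_subgradient a0 (ltW b0).
have subb := kernel_conj_subgradient b0 (ltW a0).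
have : derive1 hs a * (b - a) <= derive1 hs b * (b - a) by lra.
by rewrite ler_pM2r// subr_gt0.
Qed.

(** The candidate gradient [slope (enorm v) *: v] is a subgradient, by
Cauchy-Schwarz applied to the scalar subgradient inequality; semiconcavity then
gives the upper estimate. At [v = 0] the slope is multiplied by 0. *)
Lemma conj_fun_quadratic v w :
  0 <= F (v + w) - F v - slope (enorm v) * inner v w <= enorm w ^+ 2 / mu.
Proof.
have sub u : slope (enorm v) * inner v u <= F (v + u) - F v.
  rewrite !conj_fun_isotropic.
  have [v0|v0] := eqVneq (enorm v) 0.
    rewrite v0 invr0 mulr0 mul0r subr_ge0.
    apply: le_trans (kernel_conj_ge0 (enorm_ge0 _)).
    by have := kernel_conj_le (lexx 0); rewrite expr0n mul0r.
  have vgt0 : 0 < enorm v by rewrite lt_def v0 enorm_ge0.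
  have := kernel_conj_subgradient vgt0 (enorm_ge0 (v + u)).
  rewrite -lerBrDl; apply: le_trans; rewrite mulrAC -mulrA.
  rewrite ler_wpM2l ?kernel_conj_derive_ge0// ler_pdivrMr//.
  have := cauchy_schwarz v (v + u).
  by rewrite innerDr -sqr_enorm; lra.
have := sub w; have := sub (- w); have := conj_fun_semiconcave v w.
by rewrite innerNr mulrN => *; apply/andP; split; lra.
Qed.

Lemma derive_conj_fun v j : 'D_(delta_mx 0 j) F v = slope (enorm v) * v 0 j.
Proof.
suff : is_derive v (delta_mx 0 j : 'rV[R]_d) F (slope (enorm v) * v 0 j).
  by case.
apply: (@is_derive_quadratic _ _ _ _ _ _ mu^-1) => k.
have := conj_fun_quadratic v (k *: delta_mx 0 j).
rewrite inner_delta mulrA enormZ enorm_delta mulr1 real_normK ?num_real//.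
by rewrite (addrC v) (mulrC mu^-1).
Qed.

Hypothesis slope_nonincreasing :
  forall y z : R, 0 < y -> y <= z -> slope z <= slope y.

(** The slope is nonincreasing while the derivative is nondecreasing: together
they bound the relative variation of the slope, in place of a bound on the
second derivative of the conjugate kernel. *)
Lemma slope_lipschitz a b : 0 < a -> a <= b ->
  0 <= slope a - slope b <= slope a * ((b - a) / b).
Proof.
move=> a0 ab; have b0 := lt_le_trans a0 ab.
rewrite subr_ge0 slope_nonincreasing//=.
have := kernel_conj_derive_nondecreasing a0 ab.
rewrite -(ler_pM2r (x := b^-1)) ?invr_gt0//.
have -> : slope a * ((b - a) / b) = slope a - derive1 hs a / b.
  by field; rewrite !gt_eqF.
by lra.
Qed.

(** [v |-> slope (enorm v) *: v] is Lipschitz near [v], with a constant given by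
the slope at half the radius, the smallest radius within distance
[enorm v / 2] of [v]. *)
Lemma hess_conj_fun_slope v j k : 0 < enorm v ->
  `|hess F v j k| <= 2 * slope (enorm v / 2).
Proof.
set t := enorm v => t0; have t20 : 0 < t / 2 by rewrite divr_gt0.
have K0 : 0 <= slope (t / 2) by exact: kernel_slope_ge0.
rewrite mxE; apply: (@ler_norm_derive _ _ _ _ _ _ (t / 2)) => //.
  by rewrite mulr_ge0.
move=> s _ st; rewrite !derive_conj_fun -/t.
have := ler_dist_enorm_shift v s j; set t' := enorm _; rewrite -/t => tt'.
have t't : t / 2 <= t'.
  by move: tt'; rewrite ler_distl => /andP[? _]; lra.
have t'0 : 0 < t' by exact: lt_le_trans t't.
have slt : slope t <= slope (t / 2) by apply: slope_nonincreasing => //; lra.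
have slt' : slope t' <= slope (t / 2) by exact: slope_nonincreasing.
have sl_diff : `|slope t' - slope t| * t <= slope (t / 2) * `|s|.
  have [le_tt'|le_t't] := leP t t'.
    have /andP[sl0 slL] := slope_lipschitz t0 le_tt'.
    rewrite distrC ger0_norm// (le_trans (ler_wpM2r (ltW t0) slL))//.
    rewrite -(mulrA (slope t)) ler_pM// ?kernel_slope_ge0//.
      by rewrite mulr_ge0 ?divr_ge0 ?subr_ge0// ltW.
    rewrite ger0_norm ?subr_ge0// in tt'.
    by rewrite mulrAC ler_pdivrMr// ler_pM ?subr_ge0// ltW.
  have /andP[sl0 slL] := slope_lipschitz t'0 (ltW le_t't).
  rewrite ger0_norm// (le_trans (ler_wpM2r (ltW t0) slL))//.
  rewrite -(mulrA (slope t')) divfK ?gt_eqF// ler_pM// ?kernel_slope_ge0//.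
    by rewrite subr_ge0 ltW.
  by move: tt'; rewrite distrC ger0_norm// subr_ge0 ltW.
have -> : slope t' * (s *: delta_mx 0 j + v) 0 k - slope t * v 0 k =
    (slope t' - slope t) * v 0 k
      + slope t' * (s * (delta_mx 0 j : 'rV[R]_d) 0 k).
  move: (slope t') (slope t) (delta_mx 0 j : 'rV[R]_d) => p q u.
  by rewrite !mxE; ring.
rewrite (le_trans (ler_normD _ _))// -[2 * _ * _]mulrA mulr_natl mulr2n lerD//.
  rewrite normrM (le_trans _ sl_diff)// ler_wpM2l//.
  exact: ler_entry_enorm.
rewrite normrM (ger0_norm (kernel_slope_ge0 _))// ler_pM ?kernel_slope_ge0//.
rewrite normrM ler_piMr// (le_trans (ler_entry_enorm _ 0 k))//.
by rewrite enorm_delta.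
Qed.

(** The uniform bound dual to strong convexity; it is what remains near the
origin, where the slope bound degenerates. *)
Lemma hess_conj_fun_le v j k : `|hess F v j k| <= 8 / mu.
Proof.
have [v0|v0] := eqVneq (enorm v) 0; last first.
  have vgt0 : 0 < enorm v by rewrite lt_def v0 enorm_ge0.
  rewrite (le_trans (hess_conj_fun_slope _ _ vgt0))//.
  have : slope (enorm v / 2) <= 4 / mu.
    by apply: kernel_slope_le; rewrite divr_gt0.
  by lra.
rewrite mxE; apply: (@ler_norm_derive _ _ _ _ _ _ 1) => //.
  by rewrite divr_ge0// ltW.
move=> s s0 _; rewrite !derive_conj_fun (enorm_eq0 v0) addr0.
rewrite [X in _ - _ * X]mxE.
rewrite mulr0 subr0 enormZ enorm_delta mulr1 normrM.
have s_gt0 : 0 < `|s| by rewrite normr_gt0.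
rewrite (ger0_norm (kernel_slope_ge0 s_gt0)) ler_pM ?kernel_slope_ge0//.
  by rewrite (le_trans (kernel_slope_le s_gt0))// ler_pM2r ?invr_gt0// ler_nat.
rewrite mxE normrM ler_piMr// (le_trans (ler_entry_enorm _ 0 k))//.
by rewrite enorm_delta.
Qed.

End IsotropicConjugate.

(** * Smoothness of coercive quartics *)

Section QuarticSmoothness.
Context {R : realType} {d : nat}.
Variables (g : 'rV[R]_d -> R) (kappa R0 : R).
Hypothesis g_poly : polynomial_fun 4 g.
Hypotheses (kappa_gt0 : 0 < kappa) (R0_ge1 : 1 <= R0).
Hypothesis grad_ge : forall x, R0 <= enorm x ->
  kappa * enorm x ^+ 3 <= enorm (grad g x).

Lemma hess_growth : exists2 B : R, 0 <= B &
  forall x i j, `|hess g x i j| <= B * (1 + enorm x) ^+ 2.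
Proof.
have pDD i j := (polynomial_fun_derive i (polynomial_fun_derive j g_poly).1).1.
pose b i j := sval (cid2 (polynomial_fun_growth (pDD i j))).
have b0 i j : 0 <= b i j by rewrite /b; case: cid2.
have leb i j x : `|hess g x i j| <= b i j * (1 + enorm x) ^+ 2.
  by rewrite mxE /b; case: cid2 => c /= _; exact.
clearbody b; exists (\sum_i \sum_j b i j).
  by apply: sumr_ge0 => i _; apply: sumr_ge0.
move=> x i j; rewrite (le_trans (leb i j x))//.
rewrite ler_wpM2r ?exprn_ge0 ?addr_ge0 ?enorm_ge0//.
rewrite (bigD1 i)//= (bigD1 j)//= -addrA lerDl addr_ge0 ?sumr_ge0// => k _.
by rewrite sumr_ge0.
Qed.

(** Quadratic against cubic growth: outside a ball [L1] times the gradient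
dominates the Hessian, and [L0] takes care of the ball. *)
Lemma quartic_L0L1_smooth L1 : 0 < L1 ->
  exists2 L0 : R, 0 < L0 & L0L1_smooth L0 L1 g.
Proof.
move=> L1_gt0; have [B B0 leB] := hess_growth.
pose D := d%:R ^+ 2 * B : R; have D0 : 0 <= D by rewrite mulr_ge0 ?exprn_ge0.
have Lk0 : 0 < L1 * kappa by rewrite mulr_gt0.
pose R1 := R0 + 4 * D / (L1 * kappa).
have R01 : R0 <= R1 by rewrite lerDl divr_ge0 ?mulr_ge0// ltW.
have R1_ge0 : 0 <= R1 by rewrite (le_trans _ R01)// (le_trans _ R0_ge1).
have DR1 : 0 <= D * (1 + R1) ^+ 2 by rewrite mulr_ge0 ?exprn_ge0// addr_ge0.
exists (1 + D * (1 + R1) ^+ 2); first by rewrite ltr_pwDl.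
split=> //; first last.
- move=> x; set rho := enorm x.
  have specD : specnorm (hess g x) <= D * (1 + rho) ^+ 2.
    by rewrite /D -mulrA; apply: specnorm_le => i j; exact: leB.
  apply: le_trans specD _; have rho0 : 0 <= rho := enorm_ge0 _.
  have [rhoR1|R1rho] := leP rho R1.
    rewrite (le_trans (y := D * (1 + R1) ^+ 2))//.
      by rewrite ler_wpM2l// ler_sqr ?lerD2l// nnegrE addr_ge0.
    have : 0 <= L1 * enorm (grad g x) by rewrite mulr_ge0 ?enorm_ge0// ltW.
    by lra.
  rewrite (le_trans (y := L1 * enorm (grad g x)))//; last first.
    by rewrite lerDr addr_ge0.
  rewrite (le_trans (y := L1 * (kappa * rho ^+ 3)))//; last first.
    by rewrite ler_wpM2l ?(ltW L1_gt0)// grad_ge// ltW// (le_lt_trans R01).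
  have DLk : 4 * D <= L1 * kappa * rho.
    rewrite -ler_pdivrMl// mulrC ltW// (le_lt_trans _ R1rho)// lerDr.
    exact: le_trans R0_ge1.
  have : 4 * D * rho ^+ 2 <= L1 * kappa * rho * rho ^+ 2.
    by rewrite ler_wpM2r// sqr_ge0.
  have : D * (1 + rho) ^+ 2 <= D * (4 * rho ^+ 2).
    rewrite ler_wpM2l//.
    have : 1 <= rho := le_trans R0_ge1 (le_trans R01 (ltW R1rho)).
    by nra.
  have -> : L1 * (kappa * rho ^+ 3) = L1 * kappa * rho * rho ^+ 2 by ring.
  by lra.
- exact: polynomial_fun_C2 g_poly.
- exact: ltW.
- by rewrite addr_ge0.
Qed.

(** Outside a ball the gradient has norm at least of order [rho ^+ 3], where the
Hessian of the conjugate is at most of order [slope ((c * rho) ^+ 3)]. Its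
product with [rho ^+ 2], the growth of the Hessian of [g], is of order
[hs' ((c * rho) ^+ 3) / (c * rho)], which tends to 0. *)
Lemma quartic_anisotropic_smooth (phi : 'rV[R]_d -> \bar R) (Lbar : R) :
  reference_function phi -> cond_I phi -> 0 < Lbar ->
  exists2 L : R, 0 < L & anisotropic_smooth2 phi L Lbar g.
Proof.
move=> [_ _ [mu mu0 phi_cvx] _ phi0].
move=> [h /= [[h0 phiE] slope_nincr _ slope_cvg]] Lbar0.
set hs := fine \o conjugate *%R h in slope_nincr slope_cvg.
have [B B0 leB] := hess_growth.
(* [c <= 1] gives [c ^+ 3 <= c], hence [c ^+ 3 <= kappa / (2 * Lbar)] without
   extracting a cube root. *)
pose c := Num.min 1 (kappa / (2 * Lbar)).
have c0 : 0 < c by rewrite lt_min ltr01 divr_gt0// mulr_gt0.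
have c1 : c <= 1 by rewrite ge_min lexx.
have cL : 2 * Lbar * c <= kappa.
  by rewrite -ler_pdivlMl ?mulr_gt0// mulrC ge_min lexx orbT.
(* The choice [s := 'X^3] matches the cubic growth of the gradient. *)
have [Y Y1 leY] : exists2 Y, 1 <= Y &
    forall y, Y <= y -> `|derive1 hs (y ^+ 3) / y| <= 1.
  have /cvgrPdist_le/(_ 1 ltr01) := slope_cvg ('X^3).
  move=> [Y [_ Yle]]; exists (Num.max 1 (Y + 1)); first by rewrite le_max lexx.
  move=> y; rewrite ge_max => /andP[_ Yy].
  have := Yle y; rewrite /= hornerXn sub0r normrN; apply.
  by rewrite (lt_le_trans _ Yy)// ltrDl.
pose R1 := R0 + Y / c.
have Yc : 0 <= Y / c by rewrite divr_ge0 ?(ltW c0)// (le_trans ler01).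
have R1_ge0 : 0 <= R1 by rewrite addr_ge0// (le_trans ler01).
pose K := 8 / mu * (B * (1 + R1) ^+ 2) + 8 * B / c ^+ 2.
have Bc0 : 0 <= 8 * B / c ^+ 2.
  by rewrite divr_ge0 ?mulr_ge0 ?exprn_ge0 ?(ltW c0).
have KR1 : 0 <= 8 / mu * (B * (1 + R1) ^+ 2).
  by rewrite !mulr_ge0 ?invr_ge0 ?exprn_ge0 ?(ltW mu0)// addr_ge0.
have K0 : 0 <= K by rewrite addr_ge0.
exists ((1 + d%:R ^+ 2 * K) / Lbar).
  by rewrite divr_gt0// ltr_pwDl// mulr_ge0 ?exprn_ge0.
move=> x; rewrite divfK ?gt_eqF//.
set v := Lbar^-1 *: grad g x; set rho := enorm x.
suff [bM bM0 [leM MK]] : exists2 bM, 0 <= bM &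
    (forall i j, `|hess (conj_fun phi) v i j| <= bM) /\
    bM * (B * (1 + rho) ^+ 2) <= K.
  have bH0 : 0 <= B * (1 + rho) ^+ 2.
    by rewrite mulr_ge0 ?exprn_ge0 ?addr_ge0 ?enorm_ge0.
  rewrite (le_trans (lambda_max_mulmx_le bM0 bH0 leM (leB x)))//.
  rewrite (le_trans (y := d%:R ^+ 2 * K))//; last by rewrite lerDr.
  by rewrite ler_wpM2l ?exprn_ge0.
have rho0 : 0 <= rho := enorm_ge0 _.
have [rhoR1|R1rho] := leP rho R1.
  exists (8 / mu); first by rewrite divr_ge0 ?(ltW mu0).
  split=> [i j|].
    exact: (hess_conj_fun_le i mu0 phi_cvx phi0 h0 phiE slope_nincr).
  rewrite (le_trans (y := 8 / mu * (B * (1 + R1) ^+ 2)))//; last first.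
    by rewrite lerDl.
  rewrite ler_wpM2l ?divr_ge0 ?(ltW mu0)// ler_wpM2l//.
  by rewrite ler_sqr ?lerD2l// nnegrE addr_ge0.
have R0rho : R0 <= rho by rewrite ltW// (le_lt_trans _ R1rho)// lerDl.
have rho1 : 1 <= rho := le_trans R0_ge1 R0rho.
have Yrho : Y <= c * rho.
  rewrite -ler_pdivrMl// mulrC ltW// (le_lt_trans _ R1rho)// lerDr.
  exact: le_trans R0_ge1.
pose y := c * rho; have y0 : 0 < y by rewrite mulr_gt0//; lra.
have y3 : y ^+ 3 <= enorm v / 2.
  rewrite /v enormZ gtr0_norm ?invr_gt0// ler_pdivlMr// ler_pdivlMl//.
  apply: le_trans (grad_ge R0rho); rewrite -/rho.
  have rho3 : 0 <= rho ^+ 3 by rewrite exprn_ge0.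
  apply: le_trans (ler_wpM2r rho3 cL); rewrite /y exprMn.
  have -> : Lbar * (c ^+ 3 * rho ^+ 3 * 2) = 2 * Lbar * c ^+ 3 * rho ^+ 3.
    by ring.
  rewrite ler_wpM2r// ler_wpM2l ?mulr_ge0 ?(ltW Lbar0)// exprS.
  by rewrite ler_piMr ?(ltW c0)// expr_le1 ?(ltW c0).
have y30 : 0 < y ^+ 3 := exprn_gt0 _ y0.
have v0 : 0 < enorm v by lra.
(* The absolute value makes the bound nonnegative even when [d = 0]. *)
exists (2 * `|derive1 hs (y ^+ 3) / y ^+ 3|); first by rewrite mulr_ge0.
split=> [i j|].
  have := hess_conj_fun_slope i mu0 phi_cvx phi0 h0 phiE slope_nincr i j v0.
  move/le_trans; apply.
  rewrite ler_pM2l// (le_trans _ (ler_norm _))// slope_nincr//.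
rewrite (le_trans (y := 8 * B / c ^+ 2))//; last by rewrite lerDr.
have rho_y : rho = y / c by rewrite /y mulrC mulKf ?gt_eqF.
have le4 : B * (1 + rho) ^+ 2 <= 4 * B / c ^+ 2 * y ^+ 2.
  have -> : 4 * B / c ^+ 2 * y ^+ 2 = B * (4 * rho ^+ 2).
    by rewrite rho_y; field; rewrite gt_eqF.
  by rewrite ler_wpM2l//; nra.
have -> : derive1 hs (y ^+ 3) / y ^+ 3 = derive1 hs (y ^+ 3) / y * y ^- 2.
  by field; rewrite gt_eqF.
have y2 : 0 <= y ^- 2 by rewrite invr_ge0 exprn_ge0// ltW.
rewrite normrM (ger0_norm y2).
set q := `|_|; have q1 : q <= 1 by exact: leY.
have q0 : 0 <= q / y ^+ 2 by rewrite mulr_ge0 ?normr_ge0.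
have := ler_wpM2l q0 le4.
have -> : q / y ^+ 2 * (4 * B / c ^+ 2 * y ^+ 2) = q * (4 * B / c ^+ 2).
  by field; rewrite !gt_eqF.
have : q * (8 * B / c ^+ 2) <= 8 * B / c ^+ 2 by rewrite ler_piMl.
by lra.
Qed.

End QuarticSmoothness.

Theorem theorem2p15 (R : realType) (n r : nat) (C : 'M[R]_n) (beta : R)
    (y : 'rV[R]_n) (C_sym : C^T = C) (beta_gt0 : 0 < beta) :
  (forall L1 : R, 0 < L1 ->
     exists2 L0 : R, 0 < L0 &
       L0L1_smooth L0 L1 (fun x : 'rV[R]_(n * r) => BM_auglag C beta x y))
  /\
  (forall phi : 'rV[R]_(n * r) -> \bar R,
     reference_function phi -> cond_S phi -> cond_I phi ->
     forall Lbar : R, 0 < Lbar ->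
     exists2 L : R, 0 < L &
       anisotropic_smooth2 phi L Lbar
         (fun x : 'rV[R]_(n * r) => BM_auglag C beta x y)).
Proof.
have poly := @polynomial_BM_auglag R n r C beta y.
have [kappa kappa0 [R0 R01 grad_ge]] :=
  @enorm_grad_BM_auglag_ge R n r C beta y beta_gt0.
split=> [L1 L10|phi phi_ref _ phi_iso Lbar Lbar0].
  exact: (quartic_L0L1_smooth poly kappa0 R01 grad_ge).
exact: (quartic_anisotropic_smooth poly kappa0 R01 grad_ge phi_ref phi_iso).
Qed.
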